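(* Let $\alpha\in[0,1)$. Let $G$ be a connected graph with three edge-disjoint induced subgraphs $G_1$, $G_2$ and $G_3$ such that $V(G_1)\cap V(G_3)=\{u\}$, $V(G_2)\cap V(G_3)=\{v\}$, $\bigcup_{i=1}^3V(G_i)=V(G)$, and $G_1-u$, $G_2-v$ and $G_3-u-v$ are all nontrivial. Suppose that $uv\in E(G_3)$. For $u'\in N_{G_1}(u)$ and $v'\in N_{G_2}(v)$, let \[ G'=H+\{u'w:w\in N_{G_3-uv}(u)\}+\{uw:w\in N_{G_3-uv}(v)\} \] and \[ G''=H+\{vw:w\in N_{G_3-uv}(u)\}+\{v'w:w\in N_{G_3-uv}(v)\}, \] where $H=G-\{uw:w\in N_{G_3-uv}(u)\}-\{vw:w\in N_{G_3-uv}(v)\}$. Then $\mu_{\alpha}(G)<\mu_{\alpha}(G')$ or $\mu_{\alpha}(G)<\mu_{\alpha}(G'')$.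
   Context: All graphs are finite, simple and undirected; $d_G(u,v)$ is the distance between $u$ and $v$ in the connected graph $G$. A graph is nontrivial if it has at least two vertices. $N_H(u)$ is the set of neighbors of $u$ in $H$; $G_3-uv$ is $G_3$ with the edge $uv$ deleted; $G_1-u$ etc. denote vertex deletion. For a set $E'$ of edges, $G-E'$ and $G+E'$ denote deletion and addition of the edges in $E'$. For a connected graph $G$, the transmission of a vertex $u$ is $T_G(u)=\sum_{v\in V(G)}d_G(u,v)$, $T(G)$ is the diagonal matrix of transmissions and $D(G)=(d_G(u,v))_{u,v\in V(G)}$ the distance matrix. For $\alpha\in[0,1)$, $D_{\alpha}(G)=\alpha T(G)+(1-\alpha)D(G)$, and $\mu_{\alpha}(G)$ (the distance $\alpha$-spectral radius) is the largest eigenvalue of the symmetric matrix $D_{\alpha}(G)$.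
   Formalization: Two conditions are added, without which the claim fails: $V(G_1)\cap V(G_2)=\emptyset$, and every edge of $G$ lies in one of $G_1,G_2,G_3$, i.e. $E(G)=E(G_1)\cup E(G_2)\cup E(G_3)$. *)

(* Defs.v *)
From HB Require Import structures.
From mathcomp Require Import all_boot all_order all_algebra.
From mathcomp Require Import reals.
From mathcomp Require classical_sets.

Set Implicit Arguments.
Unset Strict Implicit.
Unset Printing Implicit Defensive.

Import Order.TTheory GRing.Theory Num.Theory.

Local Open Scope ring_scope.

Record sgraph (V : finType) := SGraph {
  adj : rel V;
  adj_sym : symmetric adj;
  adj_irr : irreflexive adj }.

Section Graphs.
Variable V : finType.
Implicit Types (G : sgraph V) (A : {set V}) (F : {set {set V}}).

Definition nbrs G (x : V) : {set V} := [set y | adj G x y].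

Definition edges G : {set {set V}} :=
  [set [set p.1; p.2] | p in [set q : V * V | adj G q.1 q.2]].

Definition connected G : Prop := forall x y, connect (adj G) x y.

(* The induced subgraph G[A] is kept on the ambient type V: the vertices outside
   A are isolated, and the vertex set of the subgraph is A itself. *)
Definition induced_adj G A : rel V :=
  fun x y => [&& x \in A, y \in A & adj G x y].

Lemma induced_sym G A : symmetric (induced_adj G A).
Proof. by move=> x y; rewrite /induced_adj adj_sym andbCA. Qed.

Lemma induced_irr G A : irreflexive (induced_adj G A).
Proof. by move=> x; rewrite /induced_adj adj_irr !andbF. Qed.

Definition induced G A : sgraph V := SGraph (@induced_sym G A) (@induced_irr G A).

Definition del_adj G F : rel V :=
  fun x y => adj G x y && ([set x; y] \notin F).

Lemma del_sym G F : symmetric (del_adj G F).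
Proof. by move=> x y; rewrite /del_adj adj_sym setUC. Qed.

Lemma del_irr G F : irreflexive (del_adj G F).
Proof. by move=> x; rewrite /del_adj adj_irr. Qed.

Definition del_edges G F : sgraph V := SGraph (@del_sym G F) (@del_irr G F).

Definition add_adj G F : rel V :=
  fun x y => adj G x y || (x != y) && ([set x; y] \in F).

Lemma add_sym G F : symmetric (add_adj G F).
Proof. by move=> x y; rewrite /add_adj adj_sym setUC eq_sym. Qed.

Lemma add_irr G F : irreflexive (add_adj G F).
Proof. by move=> x; rewrite /add_adj adj_irr eqxx. Qed.

Definition add_edges G F : sgraph V := SGraph (@add_sym G F) (@add_irr G F).

(* The set of pairs xw, for w in A. *)
Definition star (x : V) A : {set {set V}} := [set [set x; w] | w in A].

Definition walk G (n : nat) (x y : V) : bool :=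
  [exists p : n.-tuple V, path (adj G) x p && (last x p == y)].

(* A shortest walk has fewer than #|V| edges, so this search finds the least
   length of a walk from x to y; the value is #|V| if there is no such walk. *)
Definition dist G (x y : V) : nat :=
  find (fun n => walk G n x y) (iota 0 #|V|).

Lemma dist_walk G x y : connect (adj G) x y -> walk G (dist G x y) x y.
Proof.
move=> /connectP[p0 pth ->]; case: (shortenP pth) => p pthp up _.
have szp : (size p < #|V|)%N by rewrite -[(size p).+1]/(size (x :: p)) -(card_uniqP up) max_card.
have hasn : has (fun n => walk G n x (last x p)) (iota 0 #|V|).
  apply/hasP; exists (size p); first by rewrite mem_iota.
  by apply/existsP; exists (in_tuple p); rewrite /= pthp eqxx.
have := nth_find 0 hasn; rewrite nth_iota ?add0n //.
by rewrite -[X in (_ < X)%N](size_iota 0) -has_find.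
Qed.

Lemma dist_le G n x y : walk G n x y -> (n < #|V|)%N -> (dist G x y <= n)%N.
Proof.
move=> wn ltn; rewrite leqNgt; apply/negP => lt_nd.
by have := before_find 0 lt_nd; rewrite nth_iota // add0n wn.
Qed.

Definition transmission G (x : V) : nat := (\sum_(y : V) dist G x y)%N.

End Graphs.

Section DistanceAlpha.
Variables (R : realType) (V : finType).
Implicit Type G : sgraph V.

Definition trans_mx G : 'M[R]_#|V| :=
  diag_mx (\row_i (transmission G (enum_val i))%:R).

Definition dist_mx G : 'M[R]_#|V| :=
  \matrix_(i, j) (dist G (enum_val i) (enum_val j))%:R.

Definition dist_alpha_mx (alpha : R) G : 'M[R]_#|V| :=
  alpha *: trans_mx G + (1 - alpha) *: dist_mx G.

Definition largest_eigenvalue n (A : 'M[R]_n) (m : R) : Prop :=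
  eigenvalue A m /\ forall a : R, eigenvalue A a -> a <= m.

(* A symmetric real matrix of positive size has a largest eigenvalue, so the
   default value 0 of xget is only used when V is empty. *)
Definition mu (alpha : R) G : R :=
  classical_sets.xget 0 (largest_eigenvalue (dist_alpha_mx alpha G)).

End DistanceAlpha.

(* Main.v *)
Require Import Defs.
From HB Require Import structures.
From mathcomp Require Import all_boot all_order all_algebra.
From mathcomp Require Import reals.
From mathcomp Require classical_sets topology normedtype derive.
From mathcomp Require Import ring lra zify.

Set Implicit Arguments.
Unset Strict Implicit.
Unset Printing Implicit Defensive.

Import Order.TTheory GRing.Theory Num.Theory.

Local Open Scope ring_scope.

(** Let [C = V3 - u - v].  For every pair of vertices,
[2 d_G <= d_G' + d_G''], strictly for some pair: distances inside [C] and outside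
[C] do not drop, and what a vertex of [V1] loses on its way to [C] in [G'] it
gains in [G''], where [C] hangs on [v] and [v'], one step further away; the roles are
exchanged for the vertices of [V2].  With [x] a positive Perron vector of
[D_alpha(G)], comparing quadratic forms at [x] gives
[2 mu(G) < mu(G') + mu(G'')]. *)

(** * Quadratic forms: the top eigenvalue as a maximum, and a positive Perron vector *)

Section QuadraticForm.
Import classical_sets topology normedtype derive numFieldNormedType.Exports.
Variables (R : realType) (n : nat).
Implicit Types (A : 'M[R]_n) (x y z : 'rV[R]_n) (m : R).

Definition qform A z : R := \sum_i \sum_j z 0 i * A i j * z 0 j.

Definition sqnorm z : R := \sum_i z 0 i ^+ 2.

Lemma qformE A z : qform A z = \sum_j (z *m A) 0 j * z 0 j.
Proof.
rewrite /qform exchange_big; apply: eq_bigr => j _ /=.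
by rewrite mxE big_distrl.
Qed.

Lemma qform_continuous A : continuous (qform A).
Proof.
apply: (continuous_big add_continuous) => i _.
apply: (continuous_big add_continuous) => j _ z.
have coord k := @coord_continuous R 1 n 0 k z.
exact: (cvgM (cvgM (coord i) (cvg_cst _)) (coord j)).
Qed.

Lemma sqnorm_continuous : continuous sqnorm.
Proof.
apply: (continuous_big add_continuous) => i _ z.
have coord := @coord_continuous R 1 n 0 i z.
exact: (cvgM coord coord).
Qed.

Lemma sqnorm_ge0 z : 0 <= sqnorm z.
Proof. by apply: sumr_ge0 => i _; exact: sqr_ge0. Qed.

Lemma sqnorm_eq0 z : (sqnorm z == 0) = (z == 0).
Proof.
apply/eqP/eqP => [/psumr_eq0P z0|->]; last first.
  by apply: big1 => i _; rewrite mxE expr0n.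
apply/rowP => i; rewrite mxE; apply/eqP.
by rewrite -sqrf_eq0 z0 // => j _; exact: sqr_ge0.
Qed.

Lemma qformZ A a z : qform A (a *: z) = a ^+ 2 * qform A z.
Proof.
rewrite /qform big_distrr; apply: eq_bigr => i _; rewrite big_distrr.
by apply: eq_bigr => j _ /=; rewrite !mxE; ring.
Qed.

Lemma sqnormZ a z : sqnorm (a *: z) = a ^+ 2 * sqnorm z.
Proof. by rewrite big_distrr; apply: eq_bigr => i _; rewrite mxE exprMn. Qed.

(** The attained maximum of the Rayleigh quotient; with the denominator cleared, the bound also
    makes sense at [y = 0]. *)
Definition rayleigh_max A m :=
  (exists2 z, z != 0 & qform A z = m * sqnorm z) /\
  (forall y, qform A y <= m * sqnorm y).

(** The norm on row vectors is the largest absolute value of an entry, which [sqnorm z = 1] bounds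
    by 1; closedness follows from continuity of [sqnorm]. *)
Lemma unit_sphere_compact : compact [set z : 'rV[R]_n | sqnorm z = 1]%classic.
Proof.
apply: bounded_closed_compact.
  exists 1; split => // M M1 z /= z1.
  have M0 : 0 <= M by apply: ltW; apply: lt_trans M1; exact: ltr01.
  rewrite [leLHS]/Num.norm /= mx_normrE; apply: bigmax_le => // -[i j] _ /=.
  rewrite ord1; apply: le_trans (ltW M1); rewrite -(@ler_pXn2r _ 2) ?nnegrE //.
  rewrite expr1n real_normK ?num_real // -z1 /sqnorm (bigD1 j) //= lerDl.
  by apply: sumr_ge0 => k _; exact: sqr_ge0.
apply: (@preimage_closed _ _ sqnorm [set 1]%classic).
  by move=> z _; exact: sqnorm_continuous.
exact: closed_eq.
Qed.

(** The extreme value theorem gives a maximiser on the unit sphere; homogeneity of degree 2 carries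
    the bound to every vector. *)
Lemma rayleigh_max_exists A : (0 < n)%N -> exists m, rayleigh_max A m.
Proof.
move=> n_gt0.
have [||z /set_mem /= z1 zmax] := @EVT_max_rV R n (qform A) _ _ unit_sphere_compact.
- exists (delta_mx 0 (Ordinal n_gt0)) => /=.
  rewrite /sqnorm (bigD1 (Ordinal n_gt0)) //= big1 ?mxE ?eqxx ?expr1n ?addr0 //.
  by move=> i /negbTE ni; rewrite mxE ni andbF expr0n.
- exact/continuous_subspaceT/qform_continuous.
exists (qform A z); split.
  by exists z; rewrite ?z1 ?mulr1 // -sqnorm_eq0 z1 oner_eq0.
move=> y; have [->|y0] := eqVneq y 0.
  by rewrite -(scale0r 0) qformZ sqnormZ expr0n !mul0r mulr0.
have sy : 0 < sqnorm y by rewrite lt_neqAle sqnorm_ge0 eq_sym sqnorm_eq0 y0.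
have := zmax ((Num.sqrt (sqnorm y))^-1 *: y).
rewrite inE /= qformZ sqnormZ exprVn sqr_sqrtr ?sqnorm_ge0 // mulVf ?gt_eqF //.
by move=> /(_ erefl); rewrite mulrC ler_pdivrMr.
Qed.

Definition bform A x y : R := \sum_j (x *m A) 0 j * y 0 j.

(* A zero of a positive semidefinite quadratic form is a critical point: with
   [w = z (m - A)], the values at [z - t w] are [- 2 t |w|^2 + O(t^2)]. *)
Lemma rayleigh_max_eigenvector A m z : A^T = A ->
  (forall y, qform A y <= m * sqnorm y) -> qform A z = m * sqnorm z ->
  z *m A = m *: z.
Proof.
move=> symA Am Az; pose B := m%:M - A.
have qB y : qform B y = m * sqnorm y - qform A y.
  rewrite !qformE mulmxBr mul_mx_scalar.
  by rewrite big_distrr -sumrB; apply: eq_bigr => j _; rewrite !mxE /=; ring.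
pose w := z *m B; set K := qform B w.
have K_ge0 : 0 <= K by rewrite /K qB subr_ge0.
have symB : B^T = B by rewrite linearB /= symA tr_scalar_mx.
have wz : bform B w z = sqnorm w.
  transitivity ((w *m B *m z^T) 0 0).
    by rewrite mxE; apply: eq_bigr => j _; rewrite !mxE.
  have -> : w *m B *m z^T = w *m w^T by rewrite -mulmxA /w trmx_mul symB.
  rewrite [LHS]mxE; apply: eq_bigr => j _.
  by rewrite [w^T j 0]mxE expr2.
have expand t : qform B (z - t *: w) = - t * sqnorm w *+ 2 + t ^+ 2 * K.
  have -> : qform B (z - t *: w) =
      qform B z - t * bform B z w - t * bform B w z + t ^+ 2 * qform B w.
    rewrite !qformE mulmxBl -scalemxAl.
    rewrite /bform !big_distrr -!sumrB -big_split /=.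
    by apply: eq_bigr => j _; rewrite !mxE /=; ring.
  rewrite {1}qB Az subrr wz.
  have -> : bform B z w = sqnorm w by apply: eq_bigr => j _; rewrite expr2.
  by rewrite /K; ring.
have /eqP : sqnorm w = 0.
  apply/eqP; rewrite eq_le sqnorm_ge0 andbT leNgt; apply/negP => w_gt0.
  (* At [t = |w|^2 / (K + 1)] the value is [- t^2 (K + 2) < 0]; the [+ 1] keeps the denominator
     positive when [K = 0]. *)
  have : 0 <= qform B (z - (sqnorm w / (K + 1)) *: w) by rewrite qB subr_ge0.
  rewrite expand leNgt => /negP; apply.
  have K1 : 0 < K + 1 by lra.
  have -> : - (sqnorm w / (K + 1)) * sqnorm w *+ 2
      + (sqnorm w / (K + 1)) ^+ 2 * K
      = - ((sqnorm w / (K + 1)) ^+ 2 * (K + 2)).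
    by field; rewrite gt_eqF.
  by rewrite oppr_lt0 mulr_gt0 ?exprn_gt0 ?divr_gt0 //; lra.
rewrite sqnorm_eq0 /w mulmxBr mul_mx_scalar subr_eq0 => /eqP zB.
by rewrite zB.
Qed.

Lemma qform_eigenvector A a z : z *m A = a *: z -> qform A z = a * sqnorm z.
Proof.
move=> zA; rewrite qformE zA big_distrr; apply: eq_bigr => j _ /=.
by rewrite mxE -mulrA -expr2.
Qed.

Lemma rayleigh_max_largest A m : A^T = A -> rayleigh_max A m ->
  largest_eigenvalue A m.
Proof.
move=> symA [[z z0 Az] Am]; split.
  by apply/eigenvalueP; exists z => //; exact: rayleigh_max_eigenvector Am Az.
move=> a /eigenvalueP[y /qform_eigenvector ya y0].
have := Am y; rewrite ya ler_pM2r //.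
by rewrite lt_neqAle sqnorm_ge0 eq_sym sqnorm_eq0 y0.
Qed.

(* Replacing a maximiser by its entrywise absolute value does not decrease the
   quadratic form, so the absolute value is again an eigenvector. *)
Lemma perron_vector A m : A^T = A -> (forall i j, i != j -> 0 < A i j) ->
  rayleigh_max A m ->
  exists2 x : 'rV[R]_n, forall i, 0 < x 0 i & qform A x = m * sqnorm x.
Proof.
move=> symA posA [[z z0 Az] Am]; pose x : 'rV[R]_n := \row_j `|z 0 j|.
have xz : sqnorm x = sqnorm z.
  by apply: eq_bigr => j _; rewrite mxE real_normK ?num_real.
have Ax : qform A x = m * sqnorm x.
  apply/eqP; rewrite eq_le Am /= xz -Az; apply: ler_sum => i _.
  apply: ler_sum => j _; rewrite !mxE.
  (* Diagonal entries may have any sign, but their terms contain only squares of coordinates. *)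
  have [->|ij] := eqVneq i j.
    by rewrite mulrAC [leRHS]mulrAC -!expr2 real_normK ?num_real.
  by apply: le_trans (ler_norm _) _; rewrite !normrM (gtr0_norm (posA i j ij)).
exists x => // i; rewrite lt_neqAle mxE normr_ge0 andbT eq_sym.
apply/negP => /eqP xi0.
(* At a vanishing coordinate [i], the eigenvector equation is a vanishing sum of nonnegative terms
   [x k * A k i]; positive off-diagonal entries then force [x = 0], hence [z = 0]. *)
have /rowP/(_ i) := rayleigh_max_eigenvector symA Am Ax.
rewrite !mxE xi0 mulr0 => /psumr_eq0P sum0.
case/negP: z0; apply/eqP/rowP => j; rewrite mxE.
have [->|ji] := eqVneq j i; first by apply/eqP; rewrite -normr_eq0 xi0.
have term_ge0 k : true -> 0 <= x 0 k * A k i.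
  have [->|ki] := eqVneq k i; first by rewrite mxE xi0 mul0r.
  by rewrite mxE mulr_ge0 // ltW ?posA.
have /eqP := sum0 term_ge0 j isT.
by rewrite mxE mulf_eq0 normr_eq0 (gt_eqF (posA _ _ ji)) orbF => /eqP.
Qed.

End QuadraticForm.

(** * Distances in a connected graph *)

Section Distance.
Local Open Scope nat_scope.
Variable V : finType.
Implicit Types (G : sgraph V) (x y z : V) (S : {set V}).

Lemma walkP G n x y :
  reflect (exists p, [/\ size p = n, path (adj G) x p & last x p = y])
    (walk G n x y).
Proof.
apply: (iffP existsP) => [[p /andP[px /eqP <-]]|[p [pn px <-]]].
  by exists p; rewrite size_tuple.
have pt : size p == n by rewrite pn.
by exists (Tuple pt); rewrite /= px eqxx.
Qed.

Lemma dist_refl G x : dist G x x = 0.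
Proof.
apply/eqP; rewrite -leqn0; apply: dist_le; first by apply/walkP; exists [::].
by apply/card_gt0P; exists x.
Qed.

Section Connected.
Variables (G : sgraph V) (connG : connected G).

Lemma dist_lt x y : dist G x y < #|V|.
Proof.
have /connectP[p0 pth ylast] := connG x y; case: (shortenP pth) ylast => p pthp up _ ylast.
have szp : size p < #|V|.
  by rewrite -[(size p).+1]/(size (x :: p)) -(card_uniqP up) max_card.
by apply: (leq_ltn_trans _ szp); apply: dist_le => //; apply/walkP; exists p.
Qed.

Lemma dist_le_walk n x y : walk G n x y -> dist G x y <= n.
Proof.
move=> wn; have [/dist_le|le_n] := ltnP n #|V|; first exact.
exact: leq_trans (ltnW (dist_lt x y)) le_n.
Qed.

(** Follow a shortest walk from [x]: the potential [h] gains at most 1 per edge. Lower bounds on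
    distances below come from a suitable choice of [h]. *)
Lemma dist_ge_lipschitz (h : V -> nat) x y :
  (forall p q, adj G p q -> h q <= h p + 1) -> h y <= h x + dist G x y.
Proof.
move=> hG; have /walkP[p [<- + <-]] := dist_walk (connG x y).
elim: p x {y} => [|q p IHp] x /=; first by rewrite addn0.
by case/andP=> /hG hq /IHp; lia.
Qed.

Lemma dist_adj x y z : adj G y z -> dist G x z <= dist G x y + 1.
Proof.
move=> yz; have /walkP[p [<- px py]] := dist_walk (connG x y).
apply: dist_le_walk; apply/walkP; exists (rcons p z).
by rewrite size_rcons rcons_path px py yz last_rcons addn1.
Qed.

Lemma dist_triangle x y z : dist G x z <= dist G x y + dist G y z.
Proof. by apply: dist_ge_lipschitz => p q; exact: dist_adj. Qed.

Lemma dist_sym_le x y : dist G x y <= dist G y x.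
Proof.
have := @dist_ge_lipschitz (dist G ^~ y) y x; rewrite dist_refl; apply=> p q pq.
have := dist_triangle q p y; rewrite adj_sym in pq.
by have := dist_adj q pq; rewrite dist_refl; clear; lia.
Qed.

Lemma distC x y : dist G x y = dist G y x.
Proof. by apply/eqP; rewrite eqn_leq !dist_sym_le. Qed.

Lemma dist_adjl x y z : adj G x y -> dist G y z <= dist G x z + 1.
Proof. by rewrite !(distC _ z); exact: dist_adj. Qed.

Lemma dist_eq0 x y : (dist G x y == 0) = (x == y).
Proof.
apply/eqP/eqP => [d0|->]; last exact: dist_refl.
by have /walkP[p [+ _ <-]] := dist_walk (connG x y); rewrite d0 => /size0nil->.
Qed.

Lemma dist_adj1 x y : adj G x y -> dist G x y = 1.
Proof.
move=> xy; have := dist_adj x xy; rewrite dist_refl.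
have : dist G x y != 0; last lia.
by rewrite dist_eq0; apply: contraTneq xy => ->; rewrite adj_irr.
Qed.

Lemma dist_gate S x y z : (forall p q, p \in S -> q \notin S -> adj G p q -> p = x) ->
  y \in S -> z \notin S -> dist G y z = dist G y x + dist G x z.
Proof.
move=> gate yS zS; apply/eqP; rewrite eqn_leq dist_triangle /=.
(* The potential is the claimed distance from [y]; an edge across the border of [S] has its inner
   end at [x], where both formulas agree. *)
pose h t := if t \in S then dist G y t else dist G y x + dist G x t.
have := @dist_ge_lipschitz h y z; rewrite /h yS (negbTE zS) dist_refl add0n.
apply=> p q pq; have dyq := dist_adj y pq; have dxq := dist_adj x pq.
have [qS|qS] := boolP (q \in S); have [pS|pS] := boolP (p \in S) => //.
- by rewrite adj_sym in pq; rewrite (gate q p) //; lia.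
- by rewrite -(gate p q) // (dist_adj1 pq).
- by clear -dxq; lia.
Qed.

End Connected.
End Distance.

(** * Distance bounds for a single reattachment of [C] *)

Section ShiftedPart.
Local Open Scope nat_scope.
Variables (V : finType) (G G' : sgraph V) (C : {set V}) (u v u' : V).

(* The part [C], attached in [G] to the ends of the edge [uv], is detached and
   reattached to the ends of [u'u], with [u'] in the role of [u] and [u] in the
   role of [v]. *)
Definition shift_link p q :=
  (q \in C) && ((p == u') && adj G u q || (p == u) && adj G v q).

(** Edges not crossing the border of [C] are kept, and the crossing ones are exactly the new links.
    Exchanging [u] with [v] and taking [v'] for [u'] describes the second graph. *)
Definition shifted :=
  forall p q, adj G' p q = [|| adj G p q && ((p \in C) == (q \in C)),
                            shift_link p q | shift_link q p].

Hypotheses (connG : connected G) (shiftG' : shifted).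
Hypotheses (uC : u \notin C) (vC : v \notin C) (u'C : u' \notin C).
Hypotheses (uv : adj G u v) (uu' : adj G u u').
Hypothesis attachC : forall p q, p \in C -> q \notin C -> adj G p q -> q = u \/ q = v.

Let vu : adj G v u. Proof. by rewrite adj_sym. Qed.
Let u'u : adj G u' u. Proof. by rewrite adj_sym. Qed.

Lemma shifted_connected : connected G'.
Proof.
suff step x y : adj G x y -> connect (adj G') x y.
  by move=> x y; exact: connect_sub step _ _ (connG x y).
have symG' : connect_sym (adj G') by exact: sym_connect_sym (@adj_sym _ G').
have link p q : shift_link p q -> connect (adj G') p q.
  by move=> pq; apply: connect1; rewrite shiftG' pq orbT.
have same p q : p \notin C -> q \notin C -> adj G p q -> connect (adj G') p q.
  by move=> /negbTE pC /negbTE qC pq; apply: connect1; rewrite shiftG' pq pC qC.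
(* An edge from [u] into [C] is replaced by a walk through [u'], one from [v] by a walk through
   [u]. *)
have cross p q : p \in C -> q \notin C -> adj G p q -> connect (adj G') p q.
  move=> pC qC pq; have qp : adj G q p by rewrite adj_sym.
  rewrite symG'; have [qE|qE] := attachC pC qC pq; rewrite {}qE in qp *.
    apply: connect_trans (same _ _ uC u'C uu') _.
    by apply: link; rewrite /shift_link pC eqxx qp.
  apply: (@connect_trans _ _ u); first exact: same.
  by apply: link; rewrite /shift_link pC eqxx qp orbT.
move=> xy; have [xC|xC] := boolP (x \in C); have [yC|yC] := boolP (y \in C).
- by apply: connect1; rewrite shiftG' xy xC yC.
- exact: cross.
- by rewrite symG'; apply: cross; rewrite // adj_sym.
- exact: same.
Qed.

(** The potential bound with the edges of [G'] sorted by origin; links need both inequalities since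
    they are crossed in either direction. *)
Lemma shifted_lipschitz (h : V -> nat) x y :
  (forall p q, adj G p q -> (p \in C) = (q \in C) -> h q <= h p + 1) ->
  (forall c, c \in C -> adj G u c -> h c <= h u' + 1 /\ h u' <= h c + 1) ->
  (forall c, c \in C -> adj G v c -> h c <= h u + 1 /\ h u <= h c + 1) ->
  h y <= h x + dist G' x y.
Proof.
move=> hG hu hv; apply: (dist_ge_lipschitz shifted_connected) => p q.
rewrite shiftG' => /or3P[/andP[pq /eqP]|/andP[qC]|/andP[pC]].
- exact: hG.
- by case/orP=> /andP[/eqP-> ?]; [have [] := hu q|have [] := hv q].
- by case/orP=> /andP[/eqP-> ?]; [have [] := hu p|have [] := hv p].
Qed.

(** A walk enters [C] from [u'] as if from [u], or from [u] as if from [v], whence the minimum. A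
    passage through [C] is no shortcut outside, since its entrances [u'] and [u] are adjacent. *)
Lemma shifted_dist_outside x y : x \notin C ->
  (if y \in C then minn (dist G x u' + dist G u y) (dist G x u + dist G v y)
   else dist G x y) <= dist G' x y.
Proof.
move=> xC.
pose h z := if z \in C then minn (dist G x u' + dist G u z) (dist G x u + dist G v z)
            else dist G x z.
have hx : h x = 0 by rewrite /h (negbTE xC) dist_refl.
have := @shifted_lipschitz h x y; rewrite hx add0n; apply.
- move=> p q pq; rewrite /h => ->; have := dist_adj connG x pq.
  by have := dist_adj connG u pq; have := dist_adj connG v pq; case: ifP; clear; lia.
- move=> c cC uc; rewrite /h cC (negbTE u'C) (dist_adj1 connG uc).
  by have := dist_adj connG x uu'; clear; lia.
- move=> c cC vc; rewrite /h cC (negbTE uC) (dist_adj1 connG vc).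
  by have := dist_adj connG x u'u; clear; lia.
Qed.

(** Dually, a walk leaves [C] at [u'] in place of [u], or at [u] in place of [v]. A detour outside
    gains nothing because [uv] was already an edge of [G]. *)
Lemma shifted_dist_inside x y : x \in C -> y \in C -> dist G x y <= dist G' x y.
Proof.
move=> xC yC.
pose h z := if z \in C then dist G x z
            else minn (dist G x u + dist G u' z) (dist G x v + dist G u z).
have hx : h x = 0 by rewrite /h xC dist_refl.
have hy : h y = dist G x y by rewrite /h yC.
have := @shifted_lipschitz h x y; rewrite hx hy add0n; apply.
- move=> p q pq; rewrite /h => ->; have := dist_adj connG x pq.
  by have := dist_adj connG u pq; have := dist_adj connG u' pq; case: ifP; clear; lia.
- move=> c cC uc; rewrite /h cC (negbTE u'C) dist_refl (dist_adj1 connG uu').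
  have := dist_adj connG x uc; rewrite adj_sym in uc; have := dist_adj connG x uc.
  by have := dist_adj connG x vu; clear; lia.
- move=> c cC vc; rewrite /h cC (negbTE uC) dist_refl (distC connG u' u) (dist_adj1 connG uu').
  have := dist_adj connG x vc; rewrite adj_sym in vc; have := dist_adj connG x vc.
  by have := dist_adj connG x uv; clear; lia.
Qed.

End ShiftedPart.

(** * The two reattachments compared on pairs between [A] and [C] *)

Section OppositeShifts.
Local Open Scope nat_scope.
Variables (V : finType) (G G' G'' : sgraph V) (A B C : {set V}) (u v u' v' : V).
Hypotheses (connG : connected G).
Hypotheses (shiftG' : shifted G G' C u v u') (shiftG'' : shifted G G'' C v u v').
Hypotheses (uA : u \in A) (u'A : u' \in A) (vB : v \in B) (v'B : v' \in B).
Hypotheses (AC : [disjoint A & C]) (BC : [disjoint B & C]) (AB : [disjoint A & B]).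
Hypotheses (uv : adj G u v) (uu' : adj G u u') (vv' : adj G v v').
Hypothesis attachC : forall p q, p \in C -> q \notin C -> adj G p q -> q = u \/ q = v.
Hypothesis gateA : forall p q, p \in A -> q \notin A -> adj G p q -> p = u.
Hypothesis gateB : forall p q, p \in B -> q \notin B -> adj G p q -> p = v.

Let notinC : {subset A <= [predC C]}.
Proof. by move=> x xA; rewrite inE /= (disjointFr AC xA). Qed.

Let B_notinC : {subset B <= [predC C]}.
Proof. by move=> x xA; rewrite inE /= (disjointFr BC xA). Qed.

Let vu : adj G v u. Proof. by rewrite adj_sym. Qed.
Let u'u : adj G u' u. Proof. by rewrite adj_sym. Qed.

Let attachC_sym p q : p \in C -> q \notin C -> adj G p q -> q = v \/ q = u.
Proof. by move=> pC qC pq; have [] := attachC pC qC pq; [right|left]. Qed.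

Lemma opposite_shifts_cross x c : x \in A -> c \in C ->
  dist G x c + dist G x c <= dist G' x c + dist G'' x c /\
  (dist G u c <= dist G v c -> dist G u c + dist G u c < dist G' u c + dist G'' u c).
Proof.
move=> xA cC.
(* The minimum bounds the distance in [G'], which may lose 1; the other summand bounds the distance
   in [G''], which gains 1. At [y = u], with [u] no farther from [c] than [v], nothing is lost in
   [G']. *)
suff bound y : y \in A -> minn (dist G y u' + dist G u c) (dist G y u + dist G v c)
      + (dist G y u + dist G u c + 1) <= dist G' y c + dist G'' y c.
  split.
    have := bound x xA; have := dist_triangle connG x u c.
    by have := dist_adj connG x u'u; have := dist_adjl connG c vu; clear; lia.
  by move=> uc; have := bound u uA; rewrite dist_refl (dist_adj1 connG uu'); move: uc; clear; lia.
move=> yA; have yC := notinC yA.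
have := shifted_dist_outside connG shiftG' (notinC uA) (B_notinC vB) (notinC u'A) uv uu'
  attachC c yC.
have := shifted_dist_outside connG shiftG'' (B_notinC vB) (notinC uA) (B_notinC v'B) vu vv'
  attachC_sym c yC.
have vA : v \notin A by rewrite (disjointFl AB vB).
(* In [G''] the entrances [v] and [v'] lie 1 and 2 steps beyond [u]; as
   [dist G u c <= dist G v c + 1], entering from [v] gives the smaller bound. *)
have v'A : v' \notin A by rewrite (disjointFl AB v'B).
have uB : u \notin B by rewrite (disjointFr AB uA).
have yv : dist G y v = dist G y u + 1.
  by rewrite (dist_gate connG gateA yA vA) (dist_adj1 connG uv).
have yv' : dist G y v' = dist G y u + 2.
  rewrite (dist_gate connG gateA yA v'A) (distC connG u) (dist_gate connG gateB v'B uB).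
  by rewrite (distC connG v') (dist_adj1 connG vv') (dist_adj1 connG vu).
by have := dist_adjl connG c vu; rewrite cC yv yv'; clear; lia.
Qed.

End OppositeShifts.

(** * The two reattachments compared on all pairs *)

Section OppositeShiftsSum.
Local Open Scope nat_scope.
Variables (V : finType) (G G' G'' : sgraph V) (A B C : {set V}) (u v u' v' : V).
Hypotheses (connG : connected G).
Hypotheses (shiftG' : shifted G G' C u v u') (shiftG'' : shifted G G'' C v u v').
Hypotheses (uA : u \in A) (u'A : u' \in A) (vB : v \in B) (v'B : v' \in B).
Hypotheses (AC : [disjoint A & C]) (BC : [disjoint B & C]) (AB : [disjoint A & B]).
Hypotheses (uv : adj G u v) (uu' : adj G u u') (vv' : adj G v v').
Hypothesis attachC : forall p q, p \in C -> q \notin C -> adj G p q -> q = u \/ q = v.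
Hypothesis gateA : forall p q, p \in A -> q \notin A -> adj G p q -> p = u.
Hypothesis gateB : forall p q, p \in B -> q \notin B -> adj G p q -> p = v.
Hypothesis coverV : forall x, [|| x \in A, x \in B | x \in C].

Let vu : adj G v u. Proof. by rewrite adj_sym. Qed.

Let attachC_sym p q : p \in C -> q \notin C -> adj G p q -> q = v \/ q = u.
Proof. by move=> pC qC pq; have [] := attachC pC qC pq; [right|left]. Qed.

Let BA : [disjoint B & A]. Proof. by rewrite disjoint_sym. Qed.

Let crossA := opposite_shifts_cross connG shiftG' shiftG'' uA u'A vB v'B AC BC AB
  uv uu' vv' attachC gateA gateB.

(** The mirror image: [u] and [v], [A] and [B], [G'] and [G''] exchange roles. *)
Let crossB := opposite_shifts_cross connG shiftG'' shiftG' vB v'B uA u'A BC AC BA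
  vu vv' uu' attachC_sym gateB gateA.

Lemma opposite_shifts_dist x y : dist G x y + dist G x y <= dist G' x y + dist G'' x y.
Proof.
have uC : u \notin C by rewrite (disjointFr AC uA).
have u'C : u' \notin C by rewrite (disjointFr AC u'A).
have vC : v \notin C by rewrite (disjointFr BC vB).
have v'C : v' \notin C by rewrite (disjointFr BC v'B).
(* Connectedness makes the new distances symmetric, so mixed pairs may be assumed to end in [C]. *)
have connG' := shifted_connected connG shiftG' uC vC u'C uv uu' attachC.
have connG'' := shifted_connected connG shiftG'' vC uC v'C vu vv' attachC_sym.
have cross z c : z \notin C -> c \in C ->
    dist G z c + dist G z c <= dist G' z c + dist G'' z c.
  move=> /negbTE zC cC; have := coverV z; rewrite zC orbF => /orP[zA|zB].
    exact: (crossA zA cC).1.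
  by rewrite [leqRHS]addnC; exact: (crossB zB cC).1.
have [xC|xC] := boolP (x \in C); have [yC|yC] := boolP (y \in C); last 1 first.
- apply: leq_add.
    have := shifted_dist_outside connG shiftG' uC vC u'C uv uu' attachC y xC.
    by rewrite (negbTE yC).
  have := shifted_dist_outside connG shiftG'' vC uC v'C vu vv' attachC_sym y xC.
  by rewrite (negbTE yC).
- apply: leq_add.
    exact: (shifted_dist_inside connG shiftG' uC vC u'C uv uu' attachC).
  exact: (shifted_dist_inside connG shiftG'' vC uC v'C vu vv' attachC_sym).
- by rewrite (distC connG) (distC connG') (distC connG''); exact: cross.
- exact: cross.
Qed.

(** For any [c] in [C], the one of [u] and [v] nearer to [c] gives a strict pair. *)
Lemma opposite_shifts_dist_strict : C != set0 ->
  exists x y, dist G x y + dist G x y < dist G' x y + dist G'' x y.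
Proof.
case/set0Pn=> c cC; have [uvc|/ltnW vuc] := leqP (dist G u c) (dist G v c).
  by exists u, c; exact: (crossA uA cC).2.
by exists v, c; rewrite [ltnRHS]addnC; exact: (crossB vB cC).2.
Qed.

End OppositeShiftsSum.

(** * Membership in sets of unordered pairs *)

Section EdgeSets.
Local Open Scope nat_scope.
Variable V : finType.
Implicit Types (G : sgraph V) (x y w : V) (N : {set V}).

Lemma pair_eq x y p q : ([set x; y] == [set p; q]) =
  (x == p) && (y == q) || (x == q) && (y == p).
Proof.
apply/eqP/idP => [E|/orP[] /andP[/eqP-> /eqP->] //]; last by rewrite setUC.
have := set22 x y; have := set21 x y; have := set22 p q; have := set21 p q.
rewrite E -{1 2}E !inE ![_ == x]eq_sym ![_ == y]eq_sym.
by case: (x == p); case: (x == q); case: (y == p); case: (y == q).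
Qed.

Lemma mem_edges G x y : ([set x; y] \in edges G) = adj G x y.
Proof.
apply/imsetP/idP => [[[p q]] /=|xy]; last by exists (x, y); rewrite ?inE.
rewrite inE /= => pq /eqP; rewrite pair_eq.
by case/orP=> /andP[/eqP-> /eqP->] //; rewrite adj_sym.
Qed.

Lemma mem_star x N p q :
  ([set p; q] \in star x N) = (p == x) && (q \in N) || (q == x) && (p \in N).
Proof.
apply/imsetP/orP => [[w wN /eqP]|].
  by rewrite pair_eq => /orP[] /andP[/eqP-> /eqP->]; rewrite eqxx wN; [left|right].
by case=> /andP[/eqP-> ?]; [exists q|exists p; rewrite // setUC].
Qed.

End EdgeSets.

(** * The surgery on edge sets, translated into adjacency *)

Section Surgery.
Variables (V : finType) (G : sgraph V) (C : {set V}) (u v : V).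
Hypotheses (uC : u \notin C) (vC : v \notin C).
Hypothesis attachC : forall p q, p \in C -> q \notin C -> adj G p q -> q = u \/ q = v.

Let N x : {set V} := [set w in C | adj G x w].

Let H := del_edges (del_edges G (star u (N u))) (star v (N v)).

(** By [attachC], edges leaving [C] end at [u] or [v], so the two stars contain all of them, and no
    other edge. *)
Lemma adj_detach p q : adj H p q = adj G p q && ((p \in C) == (q \in C)).
Proof.
rewrite /= /del_adj /= /del_adj -andbA; case pq: (adj G p q) => //=.
have qp : adj G q p by rewrite adj_sym.
rewrite !mem_star !inE.
have [pC|pC] := boolP (p \in C); have [qC|qC] := boolP (q \in C).
- have neq x y : x \in C -> y \notin C -> x == y = false.
    by move=> xC; apply: contraNF => /eqP<-.
  by rewrite !neq.
- by have [qE|qE] := attachC pC qC pq; rewrite qE in qp *; rewrite eqxx qp orbT ?andbF.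
- by have [pE|pE] := attachC qC pC qp; rewrite pE in pq *; rewrite eqxx pq ?andbF.
- by rewrite !andbF.
Qed.

Lemma reattach_shifted u' : u' \notin C ->
  shifted G (add_edges (add_edges H (star u' (N u))) (star u (N v))) C u v u'.
Proof.
move=> u'C p q; rewrite /= /add_adj /= /add_adj adj_detach !mem_star /shift_link !inE.
(* [add_adj] excludes loops explicitly; [shift_link] does so because [u'] and [u] lie outside
   [C]. *)
have [->|pq] := eqVneq p q.
  have neq y : q \in C -> y \notin C -> q == y = false.
    by move=> qC; apply: contraNF => /eqP<-.
  by rewrite adj_irr orbb; case qC: (q \in C) => //=; rewrite !neq.
by case: (p \in C); case: (q \in C); rewrite ?andbT ?andbF ?orbF //= -orbA orbACA.
Qed.

End Surgery.

(** * From distance sums to the distance alpha-spectral radius *)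

Section SpectralRadius.
Variables (R : realType) (V : finType) (alpha : R).
Implicit Type G : sgraph V.

(** Spreading each transmission over its summands makes the form linear in the distances, with
    coefficients independent of the graph. *)
Lemma qform_dist_alpha G x : qform (dist_alpha_mx alpha G) x =
  \sum_i \sum_j (dist G (enum_val i) (enum_val j))%:R
    * (alpha * x 0 i ^+ 2 + (1 - alpha) * (x 0 i * x 0 j)).
Proof.
apply: eq_bigr => i _.
pose d (j : 'I_#|V|) : R := (dist G (enum_val i) (enum_val j))%:R.
have trans_d : (transmission G (enum_val i))%:R = \sum_j d j.
  by rewrite /transmission natr_sum (reindex _ (onW_bij _ (enum_val_bij V))).
under [RHS]eq_bigr do rewrite mulrDr.
rewrite big_split -big_distrl -/d -trans_d (bigD1 i) //= [in RHS](bigD1 i) //= addrA.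
congr (_ + _); first by rewrite !mxE eqxx mulr1n /d; ring.
by apply: eq_bigr => j ji; rewrite !mxE eq_sym (negbTE ji) mulr0n; ring.
Qed.

Lemma dist_alpha_sym G : connected G ->
  (dist_alpha_mx alpha G)^T = dist_alpha_mx alpha G.
Proof.
move=> connG; apply/matrixP => i j; rewrite !mxE (distC connG) eq_sym.
by case: eqVneq => [->|].
Qed.

(** A largest eigenvalue is unique, so [xget] returns the Rayleigh maximum; [V] nonempty ensures
    that one exists. *)
Lemma mu_rayleigh G : connected G -> (0 < #|V|)%N ->
  rayleigh_max (dist_alpha_mx alpha G) (mu alpha G).
Proof.
move=> connG V_gt0; have [m Gm] := rayleigh_max_exists (dist_alpha_mx alpha G) V_gt0.
suff -> : mu alpha G = m by [].
have [mval mmax] := rayleigh_max_largest (dist_alpha_sym connG) Gm.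
apply: classical_sets.xget_unique => // a [aval amax].
by apply/le_anti; rewrite mmax // amax.
Qed.

Hypotheses (alpha_ge0 : 0 <= alpha) (alpha_lt1 : alpha < 1).

Lemma mu_lt_of_dist G G' G'' : connected G -> connected G' -> connected G'' ->
  (forall x y, dist G x y + dist G x y <= dist G' x y + dist G'' x y)%N ->
  (exists x y, dist G x y + dist G x y < dist G' x y + dist G'' x y)%N ->
  mu alpha G < mu alpha G' \/ mu alpha G < mu alpha G''.
Proof.
move=> connG connG' connG'' le_d [a [b lt_d]].
have V_gt0 : (0 < #|V|)%N by apply/card_gt0P; exists a.
have posG i j : i != j -> 0 < dist_alpha_mx alpha G i j.
  move=> ij; rewrite !mxE (negbTE ij) mulr0n mulr0 add0r mulr_gt0 ?subr_gt0 // ltr0n.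
  by rewrite lt0n dist_eq0 // (inj_eq enum_val_inj).
have [x x_gt0 Gx] := perron_vector (dist_alpha_sym connG) posG (mu_rayleigh connG V_gt0).
have [_ /(_ x) G'x] := mu_rayleigh connG' V_gt0.
have [_ /(_ x) G''x] := mu_rayleigh connG'' V_gt0.
have sx : 0 < sqnorm x.
  rewrite lt_neqAle sqnorm_ge0 eq_sym sqnorm_eq0 andbT; apply/eqP => /rowP/(_ (Ordinal V_gt0)).
  by rewrite mxE => x0; have := x_gt0 (Ordinal V_gt0); rewrite x0 ltxx.
pose q i j := alpha * x 0 i ^+ 2 + (1 - alpha) * (x 0 i * x 0 j).
have q_gt0 i j : 0 < q i j.
  apply: ltr_wpDl; first by rewrite mulr_ge0 ?sqr_ge0.
  by rewrite mulr_gt0 ?subr_gt0 // mulr_gt0.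
(* The share of the pair [(i, j)] in the forms of [G'] and [G''] minus twice that of [G]; the pair
   [(a, b)] makes the total positive. *)
pose gain i j : R := ((dist G' (enum_val i) (enum_val j) + dist G'' (enum_val i) (enum_val j))%:R
  - (dist G (enum_val i) (enum_val j) + dist G (enum_val i) (enum_val j))%:R) * q i j.
have gain_ge0 i j : 0 <= gain i j.
  by rewrite mulr_ge0 ?(ltW (q_gt0 i j)) // subr_ge0 ler_nat.
have : 0 < \sum_i \sum_j gain i j.
  rewrite (bigD1 (enum_rank a)) //= (bigD1 (enum_rank b)) //= -addrA ltr_pwDl //.
    by rewrite mulr_gt0 // subr_gt0 ltr_nat !enum_rankK.
  by apply: addr_ge0; do ?[apply: sumr_ge0 => ? _].
have -> : \sum_i \sum_j gain i j = qform (dist_alpha_mx alpha G') x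
   + qform (dist_alpha_mx alpha G'') x - qform (dist_alpha_mx alpha G) x *+ 2.
  rewrite mulr2n !qform_dist_alpha -!big_split -sumrB; apply: eq_bigr => i _.
  rewrite -!big_split -sumrB; apply: eq_bigr => j _.
  by rewrite /gain !natrD /q /=; ring.
move: (qform (_ G) x) (qform (_ G') x) (qform (_ G'') x) Gx G'x G''x => q0 q1 q2.
move: (mu _ G) (mu _ G') (mu _ G'') => m m' m'' Gx G'x G''x gain_gt0.
(* At the Perron vector the form of [G] equals [m * sqnorm x], while the other two are at most
   [m' * sqnorm x] and [m'' * sqnorm x]. *)
suff : m *+ 2 < m' + m''.
  have [|m'_le lt2] := ltP m m'; first by left.
  right; rewrite -(ltrD2l m) -mulr2n; apply: lt_le_trans lt2 _.
  by rewrite lerD2r.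
rewrite -(ltr_pM2r sx) mulr2n !mulrDl -Gx -mulr2n -subr_gt0.
by apply: lt_le_trans gain_gt0 _; rewrite lerD2r lerD.
Qed.

End SpectralRadius.

(* G1, G2, G3 decompose G: besides the conditions displayed in the source, G1 and
   G2 share no vertex and every edge of G lies in some Gi. Both are implicit in
   the construction; the conclusion fails if either one is dropped. *)
Theorem theorem4p3 (R : realType) (alpha : R) (V : finType) (G : sgraph V)
    (V1 V2 V3 : {set V}) (u v u' v' : V) :
  let G1 := induced G V1 in
  let G2 := induced G V2 in
  let G3 := induced G V3 in
  0 <= alpha -> alpha < 1 ->
  connected G ->
  [disjoint edges G1 & edges G2] ->
  [disjoint edges G1 & edges G3] ->
  [disjoint edges G2 & edges G3] ->
  V1 :&: V3 = [set u] ->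
  V2 :&: V3 = [set v] ->
  V1 :|: V2 :|: V3 = [set: V] ->
  V1 :&: V2 = set0 ->
  edges G = edges G1 :|: edges G2 :|: edges G3 ->
  (2 <= #|V1 :\ u|)%N ->
  (2 <= #|V2 :\ v|)%N ->
  (2 <= #|V3 :\ u :\ v|)%N ->
  [set u; v] \in edges G3 ->
  u' \in nbrs G1 u ->
  v' \in nbrs G2 v ->
  let Nu := nbrs (del_edges G3 [set [set u; v]]) u in
  let Nv := nbrs (del_edges G3 [set [set u; v]]) v in
  let H := del_edges (del_edges G (star u Nu)) (star v Nv) in
  let G' := add_edges (add_edges H (star u' Nu)) (star u Nv) in
  let G'' := add_edges (add_edges H (star v Nu)) (star v' Nv) in
  mu alpha G < mu alpha G' \/ mu alpha G < mu alpha G''.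
Proof.
move=> G1 G2 G3 a_ge0 a_lt1 connG _ _ _ V13 V23 cov V12 edgesG _ _ V3_ge2 uv3 uu'1 vv'2.
move=> Nu Nv H G' G''.
have adjP p q : adj G p q -> [\/ (p \in V1) && (q \in V1), (p \in V2) && (q \in V2)
    | (p \in V3) && (q \in V3)].
  rewrite -mem_edges edgesG !inE !mem_edges /= /induced_adj.
  by case/orP=> [/orP[]|] /and3P[-> -> _]; constructor.
pose C := V3 :\ u :\ v.
have mem13 x : (x \in V1) && (x \in V3) = (x == u) by rewrite -in_setI V13 inE.
have mem23 x : (x \in V2) && (x \in V3) = (x == v) by rewrite -in_setI V23 inE.
have mem12 x : (x \in V1) && (x \in V2) = false by rewrite -in_setI V12 inE.
have memC x : x \in C = [&& x != v, x != u & x \in V3] by rewrite !inE.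
have /andP[uV1 uV3] : (u \in V1) && (u \in V3) by rewrite mem13.
have /andP[vV2 vV3] : (v \in V2) && (v \in V3) by rewrite mem23.
have uv : adj G u v by move: uv3; rewrite mem_edges => /and3P[].
move: uu'1 vv'2; rewrite !inE /= => /and3P[_ u'V1 uu'] /and3P[_ v'V2 vv'].
have V1C : [disjoint V1 & C].
  apply/pred0P => x /=; rewrite memC; apply/negP => /andP[x1 /and3P[_ /negP xu x3]].
  by apply: xu; rewrite -mem13 x1.
have V2C : [disjoint V2 & C].
  apply/pred0P => x /=; rewrite memC; apply/negP => /andP[x2 /and3P[/negP xv _ x3]].
  by apply: xv; rewrite -mem23 x2.
have V1V2 : [disjoint V1 & V2] by apply/pred0P => x /=; rewrite mem12.
have uC : u \notin C by rewrite (disjointFr V1C uV1).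
have vC : v \notin C by rewrite (disjointFr V2C vV2).
have u'C : u' \notin C by rewrite (disjointFr V1C u'V1).
have v'C : v' \notin C by rewrite (disjointFr V2C v'V2).
have cover x : [|| x \in V1, x \in V2 | x \in C].
  have : x \in V1 :|: V2 :|: V3 by rewrite cov.
  rewrite memC !inE -orbA; have [->|xv] := eqVneq x v; first by rewrite vV2 orbT.
  by have [->|xu] := eqVneq x u; first by rewrite uV1.
(* An edge meeting [C] must lie in [G3], so its end outside [C] is [u] or [v]. *)
have attachC p q : p \in C -> q \notin C -> adj G p q -> q = u \/ q = v.
  move=> pC; rewrite memC !negb_and !negbK => qC /adjP[]/andP[pV qV].
  - by rewrite (disjointFr V1C pV) in pC.
  - by rewrite (disjointFr V2C pV) in pC.
  - by case/or3P: qC => [/eqP|/eqP|]; [right|left|rewrite qV].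
(* An edge leaving [V1] must lie in [G3], so its end in [V1] is the common vertex [u]. *)
have gate1 p q : p \in V1 -> q \notin V1 -> adj G p q -> p = u.
  move=> p1 q1 /adjP[]/andP[pV qV]; first by rewrite qV in q1.
    by have := mem12 p; rewrite p1 pV.
  by apply/eqP; rewrite -mem13 p1.
have gate2 p q : p \in V2 -> q \notin V2 -> adj G p q -> p = v.
  move=> p2 q2 /adjP[]/andP[pV qV]; last by apply/eqP; rewrite -mem23 p2.
    by have := mem12 p; rewrite p2 pV.
  by rewrite qV in q2.
(* Deleting [uv] removes [v] from the neighbours of [u] in [G3], and [u] is not its own neighbour;
   what remains lies in [C]. *)
have NuE : Nu = [set w in C | adj G u w].
  apply/setP => w; rewrite !inE /= /del_adj /= /induced_adj uV3 !inE pair_eq eqxx /=.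
  have [->|wu] := eqVneq w u; first by rewrite adj_irr !andbF.
  have -> : u == v = false by apply: contraTF uv => /eqP->; rewrite adj_irr.
  by rewrite andbF orbF andbC andbA.
have NvE : Nv = [set w in C | adj G v w].
  apply/setP => w; rewrite !inE /= /del_adj /= /induced_adj vV3 !inE pair_eq eqxx /=.
  have [->|wv] := eqVneq w v; first by rewrite adj_irr !andbF.
  have -> : v == u = false by apply: contraTF uv => /eqP->; rewrite adj_irr.
  by rewrite /= andbC andbA.
have attachC_sym p q : p \in C -> q \notin C -> adj G p q -> q = v \/ q = u.
  by move=> pC qC pq; have [] := attachC p q pC qC pq; [right|left].
have shiftG' : shifted G G' C u v u' by rewrite /G' /H NuE NvE; exact: reattach_shifted.
have shiftG'' : shifted G G'' C v u v'.
  (* Exchanging [u] and [v] lists the stars in the opposite order; deletions commute, and so do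
     additions. *)
  have := reattach_shifted vC uC attachC_sym v'C; rewrite -NuE -NvE => sh p q.
  rewrite -sh /= /add_adj /= /add_adj /= /del_adj /= /del_adj.
  by rewrite -!orbA [X in _ || X]orbC -!andbA [X in _ && X]andbC.
have vu : adj G v u by rewrite adj_sym.
apply: mu_lt_of_dist => //.
- exact: (shifted_connected connG shiftG').
- exact: (shifted_connected connG shiftG'').
- exact: (opposite_shifts_dist connG shiftG' shiftG'' uV1 u'V1 vV2 v'V2).
apply: (opposite_shifts_dist_strict connG shiftG' shiftG'' uV1 u'V1 vV2 v'V2) => //.
by rewrite -card_gt0; apply: leq_trans V3_ge2.
Qed.
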